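(* Let $A\in\mathbb{R}^{m\times n}$, $c\in\mathbb{R}^n$, and $b\in[0,2\|A\|_{\infty\to\infty}]^m$. Let $\mathcal Z=[-1,1]^n\times\Delta^m$, let $g(x,y)=(A^\top y+c,\ b-Ax)$ for $(x,y)\in\mathcal Z$, let $$r(x,y)=y^\top|A|(x^2)+10\|A\|_{\infty\to\infty}\sum_{i\in[m]}y_i\log y_i,$$ and let $\lambda=3$. Run $T$ iterations of either mirror prox from an initial point $z_0\in\mathcal Z$, or dual extrapolation from an initial point $\bar z\in\mathcal Z$ (both defined in the context), on the pair $(g,r)$ with parameter $\lambda=3$. Then in either case the resulting iterates satisfy, for every iteration $t$, $$\langle g(w_t)-g(z_t),w_t-z_{t+1}\rangle\le 3\left(V^r_{z_t}(w_t)+V^r_{w_t}(z_{t+1})\right),$$ and consequently, for all $u\in\mathcal Z$, $$\sum_{0\le t<T}\langle g(w_t),w_t-u\rangle\le 3\,V^r_{z_0}(u)\quad\text{(mirror prox)},\qquad \sum_{0\le t<T}\langle g(w_t),w_t-u\rangle\le 3\,V^r_{\bar z}(u)\quad\text{(dual extrapolation)}.$$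
   Context: $\Delta^m=\{y\in\mathbb{R}^m_{\ge0}:\sum_i y_i=1\}$; $|A|$ is the entrywise absolute value of $A$; $x^2$ is the entrywise square of $x$; $\|A\|_{\infty\to\infty}=\sup_{\|x\|_\infty=1}\|Ax\|_\infty$ is the maximum $\ell_1$ norm of a row of $A$; $0\log 0=0$. The operator $g$ is the gradient operator of the box-simplex game $\min_{x\in[-1,1]^n}\max_{y\in\Delta^m}y^\top Ax-\langle b,y\rangle+\langle c,x\rangle$. Bregman divergence: $V^r_z(w)=r(w)-r(z)-\langle\nabla r(z),w-z\rangle$. Proximal operation: $\mathrm{Prox}^r_z(\xi)$ is a minimizer over $w\in\mathcal Z$ of $\langle\xi,w\rangle+V^r_z(w)$. The initial point ($z_0$ or $\bar z$) has strictly positive simplex coordinates, so that $\nabla r$ is defined there; when $A\ne0$ all later iterates then also have strictly positive simplex coordinates, and when $A=0$ we take $r\equiv0$ and $\nabla r\equiv0$. Mirror prox from $z_0$: for $0\le t<T$, $w_t=\mathrm{Prox}^r_{z_t}(\frac1\lambda g(z_t))$ and $z_{t+1}=\mathrm{Prox}^r_{z_t}(\frac1\lambda g(w_t))$. Dual extrapolation from $\bar z$: $s_0=0$; for $0\le t<T$, $z_t=\mathrm{Prox}^r_{\bar z}(s_t)$, $w_t=\mathrm{Prox}^r_{z_t}(\frac1\lambda g(z_t))$, $s_{t+1}=s_t+\frac1\lambda g(w_t)$; also $z_T=\mathrm{Prox}^r_{\bar z}(s_T)$. *)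

(* Defs.v *)
From HB Require Import structures.
From mathcomp Require Import all_boot all_order all_algebra.
From mathcomp Require Import all_classical all_reals all_analysis.

Set Implicit Arguments.
Unset Strict Implicit.
Unset Printing Implicit Defensive.

Import Order.TTheory GRing.Theory Num.Theory.
Import numFieldNormedType.Exports.

Local Open Scope classical_set_scope.
Local Open Scope ring_scope.

Section BoxSimplex.
Variable R : realType.
Variables m n : nat.

(* Pairs (x, y) have x : 'cV[R]_n and y : 'cV[R]_m. *)
Definition box : set 'cV[R]_n := [set x | forall j, -1 <= x j 0 <= 1].

Definition simplex : set 'cV[R]_m :=
  [set y | (forall i, 0 <= y i 0) /\ \sum_i y i 0 = 1].

Definition boxsimplex : set ('cV[R]_n * 'cV[R]_m) := box `*` simplex.

Definition dot (u v : 'cV[R]_n * 'cV[R]_m) : R :=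
  \sum_j u.1 j 0 * v.1 j 0 + \sum_i u.2 i 0 * v.2 i 0.

(* The library norm `|_| on matrices is the largest absolute value of an entry,
   i.e. the l_oo norm on column vectors.  For n = 0 the set is empty, and
   sup set0 = 0. *)
Definition opnorm_oo (A : 'M[R]_(m, n)) : R :=
  sup [set `|A *m x| | x in [set x : 'cV[R]_n | `|x| = 1]].

Definition gradop (A : 'M[R]_(m, n)) (b : 'cV[R]_m) (c : 'cV[R]_n)
    (z : 'cV[R]_n * 'cV[R]_m) : 'cV[R]_n * 'cV[R]_m :=
  (A^T *m z.2 + c, b - A *m z.1).

(* Since ln 0 = 0 in the library, the convention 0 log 0 = 0 holds.  The formula
   is used on the whole space, so that r can be differentiated at points of the
   box-simplex with positive simplex coordinates; when A = 0 it is
   identically 0. *)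
Definition areareg (A : 'M[R]_(m, n)) (z : 'cV[R]_n * 'cV[R]_m) : R :=
  ((z.2)^T *m map_mx Num.norm A *m map_mx (fun a => a ^+ 2) z.1) 0 0
  + 10 * opnorm_oo A * \sum_i z.2 i 0 * ln (z.2 i 0).

Section Algorithms.
Variable Z : set ('cV[R]_n * 'cV[R]_m).
Variable g : 'cV[R]_n * 'cV[R]_m -> 'cV[R]_n * 'cV[R]_m.
Variable r : 'cV[R]_n * 'cV[R]_m -> R.
Variable lambda : R.

Definition gradient (z : 'cV[R]_n * 'cV[R]_m) : 'cV[R]_n * 'cV[R]_m :=
  (\col_j 'D_((delta_mx j 0, 0) : 'cV[R]_n * 'cV[R]_m) r z,
   \col_i 'D_((0, delta_mx i 0) : 'cV[R]_n * 'cV[R]_m) r z).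

Definition bregman (z w : 'cV[R]_n * 'cV[R]_m) : R :=
  r w - r z - dot (gradient z) (w - z).

(* Minimizers need not be unique, so the proximal operation is a relation:
   is_prox z xi w says that w is an admissible value of Prox^r_z(xi). *)
Definition is_prox (z xi w : 'cV[R]_n * 'cV[R]_m) : Prop :=
  Z w /\
  forall w', Z w' -> dot xi w + bregman z w <= dot xi w' + bregman z w'.

Definition mirror_prox (T : nat) (z0 : 'cV[R]_n * 'cV[R]_m)
    (z w : nat -> 'cV[R]_n * 'cV[R]_m) : Prop :=
  z 0%N = z0 /\
  forall t, (t < T)%N ->
    is_prox (z t) (lambda^-1 *: g (z t)) (w t) /\
    is_prox (z t) (lambda^-1 *: g (w t)) (z t.+1).

Definition dual_extrapolation (T : nat) (zbar : 'cV[R]_n * 'cV[R]_m)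
    (s z w : nat -> 'cV[R]_n * 'cV[R]_m) : Prop :=
  [/\ s 0%N = 0,
      forall t, (t < T)%N ->
        [/\ is_prox zbar (s t) (z t),
            is_prox (z t) (lambda^-1 *: g (z t)) (w t) &
            s t.+1 = s t + lambda^-1 *: g (w t)] &
      is_prox zbar (s T) (z T)].

End Algorithms.
End BoxSimplex.

(* Main.v *)
(* Let N = ||A||_(oo->oo).  At a proximal point w of z, the partial derivatives in
   y of the objective, namely those of <xi, .> + r minus those of r at z, agree,
   so the log-ratios of the y-coordinates of w and z are, up to a common constant,
   (1/(10 N)) times terms whose range is at most 4N/3 (gradient operator, using
   0 <= b <= 2 N) plus 2N (the part |A|(x^2) of the gradient of r).  Hence each
   y-coordinate changes by a factor at most e^(1/3) <= 3/2 from z to w, and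
   likewise from w to the next iterate.  Since every row of |A| sums to at most N,
   the local relative Lipschitz inequality splits over the entries of A; for each
   entry, once the y-coordinates are comparable and the Kullback-Leibler term is
   bounded below by (a - b)^2 / (2 (a + b)), a quadratic inequality in four
   variables remains.  The regret bounds then follow by telescoping, using the
   three-point identity and V >= 0. *)
Require Import Defs.
From mathcomp Require Import all_boot all_order all_algebra.
From mathcomp Require Import all_classical all_reals all_analysis.
From mathcomp Require Import ring lra.
Import Order.TTheory GRing.Theory Num.Theory.
Import numFieldNormedType.Exports.
Local Open Scope classical_set_scope.
Local Open Scope ring_scope.

(** * Scalar inequalities for the entropy and for a single matrix entry *)

Section Scalars.
Set Implicit Arguments.
Unset Strict Implicit.
Variable R : realType.
Implicit Types a b x y s t : R.

(** The unnormalized Kullback-Leibler term a log(a/b) - a + b, kept in the shape of a Bregman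
    divergence of t log t so that it can be matched term by term in [bregmanE]. *)
Definition kl a b : R := a * ln a - b * ln b - (ln b + 1) * (a - b).

(* The share of one entry of A, divided by its absolute value, in a lower bound of
   the Bregman divergence: N in the entropy term dominates the row sums of |A|. *)
Definition entry_div x y x' y' : R :=
  y * (x' - x) ^+ 2 + (y' - y) * (x' ^+ 2 - x ^+ 2) + 10 * kl y' y.

Lemma ln_le_subr1 x : 0 < x -> ln x <= x - 1.
Proof.
move=> x0; rewrite -[X in ln X](subrKC 1) le_ln1Dx //.
by rewrite ltrBrDl subrr.
Qed.

(* Writing [b = a e^2], the bound [ln e <= e - 1] gives
   [kl a b >= a (1 - e)^2 = (sqrt a - sqrt b)^2]. *)
Lemma kl_ge a b : 0 <= a -> 0 < b -> (a - b) ^+ 2 / (2 * (a + b)) <= kl a b.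
Proof.
move=> a0 b0; rewrite ler_pdivrMr; last by lra.
rewrite /kl; move: a0; rewrite le_eqVlt => /predU1P[<-|a0].
  by rewrite mul0r; nra.
pose e := Num.sqrt (b / a).
have e0 : 0 < e by rewrite sqrtr_gt0 divr_gt0.
have be : b = a * e ^+ 2.
  by rewrite sqr_sqrtr ?divr_ge0 ?ltW// mulrC divfK// gt_eqF.
have lnb : ln b = ln a + 2 * ln e.
  by rewrite be lnM ?posrE ?exprn_gt0// lnXn// mulr_natl.
have := ln_le_subr1 e0; rewrite lnb be.
move: (ln a) (ln e) => p q qe.
have -> : (a * p - a * e ^+ 2 * (p + 2 * q) - (p + 2 * q + 1) * (a - a * e ^+ 2))
   = a * (e ^+ 2 - 1 - 2 * q) by ring.
have h1 : a * (e - 1) ^+ 2 <= a * (e ^+ 2 - 1 - 2 * q).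
  by rewrite ler_pM2l//; lra.
(* This is (1 + e)^2 <= 2 (1 + e^2), with gap (1 - e)^2. *)
have h2 : (a - a * e ^+ 2) ^+ 2 <= a * (e - 1) ^+ 2 * (2 * (a + a * e ^+ 2)).
  rewrite -subr_ge0; have -> : a * (e - 1) ^+ 2 * (2 * (a + a * e ^+ 2))
     - (a - a * e ^+ 2) ^+ 2 = (a * (e - 1) ^+ 2) ^+ 2 by ring.
  exact: sqr_ge0.
apply: le_trans h2 _; rewrite ler_wpM2r//.
have := sqr_ge0 e; nra.
Qed.

Lemma kl_ge0 a b : 0 <= a -> 0 < b -> 0 <= kl a b.
Proof.
move=> a0 b0; apply: le_trans (kl_ge a0 b0).
by rewrite divr_ge0 ?sqr_ge0//; lra.
Qed.

Lemma kl_le a b : 0 <= a -> 0 < b -> kl a b <= (a - b) ^+ 2 / b.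
Proof.
move=> a0 b0; rewrite ler_pdivlMr// /kl.
move: a0; rewrite le_eqVlt => /predU1P[<-|a0]; first by rewrite mul0r; nra.
have ab0 : 0 < a / b by rewrite divr_gt0.
have := ln_le_subr1 ab0; rewrite ln_div ?posrE// => lnab.
have : b * (ln a - ln b) <= a - b.
  by rewrite mulrC -ler_pdivlMr// mulrBl divff ?gt_eqF.
by nra.
Qed.

(** The tangent at the intermediate point supports the function at both ends, which is [kl_ge0]
    twice. The case a = 0 matters where a proximal point is not yet known to be positive. *)
Lemma xlnx_convex a b t : 0 <= a -> 0 < b -> 0 < t <= 1 ->
  (a + t * (b - a)) * ln (a + t * (b - a))
    <= a * ln a + t * (b * ln b - a * ln a).
Proof.
move=> a0 b0 /andP[t0 t1].
have p0 : 0 < a + t * (b - a) by nra.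
have := kl_ge0 a0 p0; have := kl_ge0 (ltW b0) p0.
rewrite /kl; move: (ln _) (a * ln a) (b * ln b) => l A B h1 h2.
have : 0 <= t * (B - (a + t * (b - a)) * l - (l + 1) * (b - (a + t * (b - a))))
   + (1 - t) * (A - (a + t * (b - a)) * l - (l + 1) * (a - (a + t * (b - a)))).
  by rewrite addr_ge0// mulr_ge0//; lra.
by nra.
Qed.

Lemma sqr_diff_ge x x' s : `|x| <= 1 -> `|x'| <= 1 ->
  - (2 * `|s| * `|x' - x|) <= s * (x' ^+ 2 - x ^+ 2).
Proof.
move=> x1 x'1; rewrite lerNl -mulrN.
have -> : 2 * `|s| * `|x' - x| = `|s| * (`|x' - x| * 2) by ring.
apply: le_trans (ler_norm _) _.
rewrite normrM normrN ler_wpM2l// subr_sqr normrM ler_wpM2l//.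
by apply: le_trans (ler_normD _ _) _; lra.
Qed.

(** No closeness of y and y' is assumed, so this also serves arbitrary comparison points.
    Multiplying by the larger of y and y' leaves a completed square plus a remainder that [kl_ge]
    controls. *)
Lemma entry_div_ge0 x y x' y' : `|x| <= 1 -> `|x'| <= 1 -> 0 < y -> 0 <= y' ->
  0 <= entry_div x y x' y'.
Proof.
move=> x1 x'1 y0 y'0; rewrite /entry_div.
have := kl_ge y'0 y0; set k := kl _ _; rewrite ler_pdivrMr; last by lra.
move=> hk.
have k0 : 0 <= k by exact: kl_ge0.
have [yy'|y'y] := leP y y'.
  have hk2 : (y' - y) ^+ 2 <= 10 * k * y' by nra.
  have x2 : x ^+ 2 <= 1 by rewrite -real_normK ?num_real// expr_le1.
  rewrite -(@pmulr_rge0 _ y'); last by lra.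
  have -> : y' * (y * (x' - x) ^+ 2 + (y' - y) * (x' ^+ 2 - x ^+ 2) + 10 * k)
    = (y' * x' - y * x) ^+ 2 + ((1 - x ^+ 2) * (y' - y) ^+ 2)
      + (10 * k * y' - (y' - y) ^+ 2) by ring.
  by rewrite addr_ge0 ?subr_ge0// addr_ge0 ?sqr_ge0// mulr_ge0 ?sqr_ge0 ?subr_ge0.
have key (S D q : R) : - (2 * S * D) <= q -> S ^+ 2 <= 10 * k * y ->
    0 <= y * (y * D ^+ 2 + q + 10 * k).
  move=> /(ler_wpM2l (ltW y0)) hq hS; have := sqr_ge0 (y * D - S); nra.
rewrite -(@pmulr_rge0 _ y)// -[(x' - x) ^+ 2]real_normK ?num_real//.
apply: (key `|y' - y|); first exact: sqr_diff_ge.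
by rewrite real_normK ?num_real//; nra.
Qed.

(** By [kl_ge] and 2 (y + y') <= 5 p, the entropy term is at least 2 (y' - y)^2 / p; a common p
    makes two consecutive steps comparable. *)
Lemma entry_div_ge_quad x y x' y' p : `|x| <= 1 -> `|x'| <= 1 ->
    0 < p -> 0 < y -> 0 <= y' -> y + y' <= 5 / 2 * p ->
  y * `|x' - x| ^+ 2 - 2 * `|y' - y| * `|x' - x| + 2 * `|y' - y| ^+ 2 / p
    <= entry_div x y x' y'.
Proof.
move=> x1 x'1 p0 y0 y'0 yp; rewrite /entry_div !real_normK ?num_real//.
rewrite lerD ?lerD ?sqr_diff_ge// (le_trans _ (ler_wpM2l _ (kl_ge y'0 y0)))//.
rewrite [leRHS]mulrA ler_pdivlMr; last by lra.
rewrite mulrAC ler_pdivrMr//.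
have := sqr_ge0 (y' - y); nra.
Qed.

Lemma entry_rel_lip (xz xw xu yz yw yu : R) :
    `|xz| <= 1 -> `|xw| <= 1 -> `|xu| <= 1 ->
    0 < yz -> 0 < yw -> 0 < yu ->
    yz <= 3 / 2 * yw -> yw <= 3 / 2 * yz -> yu <= 3 / 2 * yw ->
  `|(yu - yw) * (xw - xz) - (yw - yz) * (xu - xw)|
    <= 3 * (entry_div xz yz xw yw + entry_div xw yw xu yu).
Proof.
move=> xz1 xw1 xu1 yz0 yw0 yu0 zw wz uw.
have h1 : yz + yw <= 5 / 2 * yw by lra.
have h2 : yw + yu <= 5 / 2 * yw by lra.
have := entry_div_ge_quad xw1 xu1 yw0 yw0 (ltW yu0) h2.
have := entry_div_ge_quad xz1 xw1 yw0 yz0 (ltW yw0) h1.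
set E1 := entry_div _ _ _ _; set E2 := entry_div _ _ _ _ => hE1 hE2.
apply: le_trans (ler_normB _ _) _; rewrite !normrM.
(* Changes measured relative to yw let yw factor out of the inequality. *)
have [t tE] : exists t, `|yu - yw| = yw * t.
  by exists (`|yu - yw| / yw); rewrite mulrC divfK// gt_eqF.
have [s sE] : exists s, `|yw - yz| = yw * s.
  by exists (`|yw - yz| / yw); rewrite mulrC divfK// gt_eqF.
move: hE1 hE2; rewrite {}tE {}sE.
move: (`|xw - xz| : R) (`|xu - xw| : R) => D X.
have -> : 2 * (yw * s) ^+ 2 / yw = yw * (2 * s ^+ 2) by field; rewrite gt_eqF.
have -> : 2 * (yw * t) ^+ 2 / yw = yw * (2 * t ^+ 2) by field; rewrite gt_eqF.
move=> hE1 hE2.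
(* The coefficient 2 of D^2 comes from 3 yz >= 2 yw. Right side minus left side is (3D - 5t)^2/30 +
   (s - X)^2/2 + (17D - 30s)^2/170 + (5X - 6t)^2/10 plus positive multiples of s^2 and t^2. *)
have : t * D + s * X <= 2 * D ^+ 2 - 6 * (s * D) + 6 * s ^+ 2
    + 3 * X ^+ 2 - 6 * (t * X) + 6 * t ^+ 2.
  have := sqr_ge0 (3 * D - 5 * t); have := sqr_ge0 (s - X).
  have := sqr_ge0 (17 * D - 30 * s); have := sqr_ge0 (5 * X - 6 * t).
  have := sqr_ge0 s; have := sqr_ge0 t.
  by nra.
rewrite -(ler_pM2l yw0) => H.
have : 2 * (yw * D ^+ 2) <= 3 * (yz * D ^+ 2) by have := sqr_ge0 D; nra.
by nra.
Qed.

End Scalars.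

(** * Row sums against the operator norm *)

Section Norms.
Set Implicit Arguments.
Unset Strict Implicit.
Variables (R : realType).

Lemma entry_le_mx_norm p q (B : 'M[R]_(p, q)) i j : `|B i j| <= `|B|.
Proof.
rewrite [leRHS]mx_normrE.
exact: (le_bigmax _ (fun ij : 'I_p * 'I_q => `|B ij.1 ij.2|) (i, j)).
Qed.

Lemma mx_norm_le p q (B : 'M[R]_(p, q)) e : 0 <= e ->
  (forall i j, `|B i j| <= e) -> `|B| <= e.
Proof. by move=> e0 Be; rewrite [leLHS]mx_normrE; apply: bigmax_le. Qed.

Lemma mulmx_entry_le m n (A : 'M[R]_(m, n)) (x : 'cV[R]_n) i e :
    (forall j, `|x j 0| <= e) ->
  `|(A *m x) i 0| <= (\sum_j `|A i j|) * e.
Proof.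
move=> xe; rewrite mxE mulr_suml (le_trans (ler_norm_sum _ _ _))//.
by apply: ler_sum => j _; rewrite normrM ler_wpM2l.
Qed.

(** The sign vector of row i has norm 1, and its image has the row sum as i-th entry. For n = 0 both
    sides are 0. *)
Lemma row_sum_le_opnorm m n (A : 'M[R]_(m, n)) i : \sum_j `|A i j| <= opnorm_oo A.
Proof.
case: n A => [|k] B.
  rewrite big_ord0 /opnorm_oo.
  rewrite (_ : [set _ | _ in _] = set0) ?sup0//.
  apply/seteqP; split => // _ /= [x /eqP + _].
  by rewrite (_ : x = 0) ?normr0 ?(eq_sym 0) ?oner_eq0//; apply/colP => -[].
pose x : 'cV[R]_k.+1 := \col_j (-1) ^+ (B i j < 0)%R.
have x1 : `|x| = 1.
  apply/le_anti/andP; split.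
    by apply: mx_norm_le => // j j'; rewrite mxE normrX normrN1 expr1n.
  by have := entry_le_mx_norm x ord0 ord0; rewrite mxE normrX normrN1 expr1n.
(* [sup] dominates the elements only of a bounded set; the sum of all absolute entries is a crude
   bound. *)
have ub : has_ubound [set `|B *m x| | x in [set x : 'cV[R]_k.+1 | `|x| = 1]].
  exists (\sum_i' \sum_j `|B i' j|) => _ /= [u u1 <-].
  apply: mx_norm_le => [|i' j'].
    by apply: sumr_ge0 => i' _; apply: sumr_ge0.
  rewrite (ord1 j') (le_trans (@mulmx_entry_le _ _ B u i' 1 _))//.
    by move=> j; rewrite -u1; exact: entry_le_mx_norm.
  rewrite mulr1 (bigD1 i')//= lerDl.
  by apply: sumr_ge0 => ? _; apply: sumr_ge0.
apply: le_trans (ub_le_sup ub _); last by exists x => //; exact: x1.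
apply: le_trans (entry_le_mx_norm _ i 0); rewrite mxE.
apply: le_trans (ler_norm _); apply: ler_sum => j _.
by rewrite mxE mulrC -normrEsign.
Qed.

End Norms.

(** * The regularizer, its gradient and its Bregman divergence *)

Section Regularizer.
Set Implicit Arguments.
Unset Strict Implicit.
Variables (R : realType) (m n : nat) (A : 'M[R]_(m, n)).
Implicit Types z w u : 'cV[R]_n * 'cV[R]_m.

Local Notation N := (opnorm_oo A).

Lemma opnorm_eq0 : N = 0 -> A = 0.
Proof.
move=> N0; apply/matrixP => i j; rewrite mxE; apply/eqP; rewrite -normr_le0.
rewrite -[leRHS]N0 (le_trans _ (row_sum_le_opnorm A i))// (bigD1 j)//= lerDl.
exact: sumr_ge0.
Qed.

(** A point of the simplex forces m > 0, so that there is a row to compare with. *)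
Lemma simplex_opnorm_ge0 z : boxsimplex z -> 0 <= N.
Proof.
move=> [_ [_]]; case: m A z => [B z|k B z _].
  by rewrite big_ord0 => /eqP; rewrite eq_sym oner_eq0.
by apply: le_trans (row_sum_le_opnorm B ord0); exact: sumr_ge0.
Qed.

Lemma box_norm_le1 z j : boxsimplex z -> `|z.1 j 0| <= 1.
Proof. by move=> [zb _]; rewrite ler_norml; exact: zb. Qed.

Lemma areareg_sumE z : areareg A z =
  \sum_i \sum_j `|A i j| * (z.2 i 0 * z.1 j 0 ^+ 2)
  + 10 * N * \sum_i z.2 i 0 * ln (z.2 i 0).
Proof.
rewrite /areareg mxE exchange_big; congr (_ + _).
apply: eq_bigr => j _; rewrite !mxE mulr_suml; apply: eq_bigr => i _.
by rewrite !mxE; ring.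
Qed.

Lemma areareg_opnorm0 : N = 0 -> areareg A = cst 0.
Proof.
move=> N0; apply/funext => z; rewrite areareg_sumE N0 mulr0 mul0r addr0 /=.
rewrite (opnorm_eq0 N0) big1// => i _.
by rewrite big1// => j _; rewrite mxE normr0 mul0r.
Qed.

(* Where [areareg_grad] is the gradient: for N = 0 the regularizer vanishes
   identically. *)
Definition regular z := N = 0 \/ forall i, 0 < z.2 i 0.

Definition areareg_grad z : 'cV[R]_n * 'cV[R]_m :=
  (\col_j \sum_i `|A i j| * (2 * z.2 i 0 * z.1 j 0),
   \col_i (\sum_j `|A i j| * z.1 j 0 ^+ 2 + 10 * N * (ln (z.2 i 0) + 1))).

Lemma derive_line (V : normedModType R) (f : V -> R) (a v : V) (l : R) :
  is_derive (0 : R) 1 (fun h : R => f (h *: v + a)) l -> 'D_v f a = l.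
Proof.
move=> fl; rewrite -(derive_val (is_derive := fl)) /derive /=.
set q := (X in X @ _); set q' := (X in _ = lim (X @ _)).
suff -> : q = q' by [].
by apply/funext => h; rewrite /q /q' /= scale0r add0r addr0 [h *: 1]mulr1.
Qed.

(** The shape of the regularizer along an x-coordinate; [is_derive_xlnx] covers a y-coordinate. *)
Lemma is_derive_quadratic (c l q : R) :
  is_derive (0 : R) 1 (fun h : R => c + l * h + q * h ^+ 2) l.
Proof.
have did := is_derive_id (0 : R) 1.
have d := is_deriveD (is_deriveD (is_derive_cst c (0 : R) 1) (is_deriveZ l did))
  (is_deriveZ q (is_deriveX 2 did)).
apply: (is_derive_eq d).
by rewrite /= add0r mulr0 scale0r scaler0 addr0 [l *: 1]mulr1.
Qed.

Lemma is_derive_xlnx (c l q y : R) : 0 < y ->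
  is_derive (0 : R) 1 (fun h : R => c + l * h + q * ((h + y) * ln (h + y)))
    (l + q * (ln y + 1)).
Proof.
move=> y0.
have did := is_derive_id (0 : R) 1.
have ds := is_deriveD did (is_derive_cst y (0 : R) 1).
have s0 : (id + cst y : R -> R) 0 = y by rewrite fctE add0r.
have dl : is_derive (0 : R) 1 (@ln R \o (id + cst y)) (y^-1 * (1 + 0)).
  by apply: is_derive1_comp; rewrite s0; exact: is_derive1_ln.
have d := is_deriveD (is_deriveD (is_derive_cst c (0 : R) 1) (is_deriveZ l did))
  (is_deriveZ q (is_deriveM ds dl)).
apply: (is_derive_eq d).
rewrite /= s0 add0r addr0 [l *: 1]mulr1 mulr1; congr (_ + _ * _).
by rewrite [y *: _]mulfV ?gt_eqF// [_ *: 1]mulr1 addrC.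
Qed.

Lemma sum_delta k (F : 'I_k -> R) j : \sum_i F i * (i == j)%:R = F j.
Proof.
rewrite (bigD1 j)//= eqxx mulr1 big1 ?addr0// => i /negbTE ->.
by rewrite mulr0.
Qed.

Lemma gradientE z : regular z -> gradient (areareg A) z = areareg_grad z.
Proof.
have [N0 _|/eqP N0 [//|z0]] := eqVneq N 0.
  rewrite areareg_opnorm0// /areareg_grad (opnorm_eq0 N0) /gradient.
  congr (_, _); apply/colP => i; rewrite !mxE derive_cst.
    by rewrite big1// => j _; rewrite mxE normr0 mul0r.
  rewrite big1 => [|j _]; first by rewrite -(opnorm_eq0 N0) N0 mulr0 mul0r addr0.
  by rewrite mxE normr0 mul0r.
congr (_, _); apply/colP => k; rewrite !mxE; apply: derive_line.
  rewrite [X in is_derive _ _ X](_ : _ = fun h : R => areareg A z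
    + (\sum_i `|A i k| * (2 * z.2 i 0 * z.1 k 0)) * h
    + (\sum_i `|A i k| * z.2 i 0) * h ^+ 2); first exact: is_derive_quadratic.
  apply/funext => h; rewrite !areareg_sumE /=.
  have -> : \sum_i (h *: 0 + z.2) i 0 * ln ((h *: 0 + z.2) i 0)
      = \sum_i z.2 i 0 * ln (z.2 i 0).
    by apply: eq_bigr => i _; rewrite !mxE mulr0 add0r.
  suff -> : \sum_i \sum_j `|A i j| * ((h *: 0 + z.2) i 0
        * (h *: delta_mx k 0 + z.1) j 0 ^+ 2) =
      \sum_i \sum_j `|A i j| * (z.2 i 0 * z.1 j 0 ^+ 2)
      + (\sum_i `|A i k| * (2 * z.2 i 0 * z.1 k 0)) * h
      + (\sum_i `|A i k| * z.2 i 0) * h ^+ 2 by ring.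
  rewrite !mulr_suml -!big_split; apply: eq_bigr => i _ /=.
  rewrite -addrA [X in _ = _ + X](_ : _ = `|A i k| * (2 * z.2 i 0 * z.1 k 0 * h
    + z.2 i 0 * h ^+ 2)); last by ring.
  rewrite -(sum_delta (fun j => `|A i j| * (2 * z.2 i 0 * z.1 j 0 * h
    + z.2 i 0 * h ^+ 2)) k) -big_split /=.
  apply: eq_bigr => j _; rewrite !mxE eqxx andbT mulr0 add0r.
  by case: (j == k) => /=; ring.
(* Only the k-th entropy term varies nonlinearly: it is removed from the constant and put back at h
   + z.2 k. *)
rewrite [X in is_derive _ _ X](_ : _ = fun h : R => areareg A z
  - 10 * N * (z.2 k 0 * ln (z.2 k 0))
  + (\sum_j `|A k j| * z.1 j 0 ^+ 2) * h
  + 10 * N * ((h + z.2 k 0) * ln (h + z.2 k 0))); first exact: is_derive_xlnx.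
apply/funext => h; rewrite !areareg_sumE /=.
set P := \sum_i \sum_j `|A i j| * (z.2 i 0 * _).
set S := \sum_i z.2 i 0 * _.
have -> : \sum_i \sum_j `|A i j| * ((h *: delta_mx k 0 + z.2) i 0
      * (h *: 0 + z.1) j 0 ^+ 2) = P + (\sum_j `|A k j| * z.1 j 0 ^+ 2) * h.
  rewrite -(sum_delta (fun i => \sum_j `|A i j| * z.1 j 0 ^+ 2) k) mulr_suml.
  rewrite -big_split; apply: eq_bigr => i _ /=; rewrite -mulrA mulr_suml.
  rewrite -big_split; apply: eq_bigr => j _ /=.
  by rewrite !mxE eqxx andbT; ring.
suff -> : \sum_i (h *: delta_mx k 0 + z.2) i 0 * ln ((h *: delta_mx k 0 + z.2) i 0)
    = S - z.2 k 0 * ln (z.2 k 0) + (h + z.2 k 0) * ln (h + z.2 k 0) by ring.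
rewrite /S [LHS](bigD1 k)//= [in RHS](bigD1 k)//=.
have -> : \sum_(i < m | i != k) (h *: delta_mx k 0 + z.2) i 0
    * ln ((h *: delta_mx k 0 + z.2) i 0)
    = \sum_(i < m | i != k) z.2 i 0 * ln (z.2 i 0).
  by apply: eq_bigr => i /negbTE ik; rewrite !mxE ik mulr0 add0r.
by rewrite !mxE !eqxx mulr1; ring.
Qed.

(** Entrywise, y'x'^2 - yx^2 - 2yx(x' - x) - x^2(y' - y) equals y(x' - x)^2 + (y' - y)(x'^2 -
    x^2). *)
Lemma bregmanE z w : regular z -> bregman (areareg A) z w =
  \sum_i \sum_j `|A i j| * (z.2 i 0 * (w.1 j 0 - z.1 j 0) ^+ 2
     + (w.2 i 0 - z.2 i 0) * (w.1 j 0 ^+ 2 - z.1 j 0 ^+ 2))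
  + 10 * N * \sum_i kl (w.2 i 0) (z.2 i 0).
Proof.
move=> zr; rewrite /bregman gradientE// !areareg_sumE /dot /=.
set P := \sum_i \sum_j _; set Q := \sum_i \sum_j _.
set X := \sum_j _; set Y := \sum_i _.
pose U := \sum_i \sum_j `|A i j| * (2 * z.2 i 0 * z.1 j 0 * (w.1 j 0 - z.1 j 0)).
pose W := \sum_i \sum_j `|A i j| * (z.1 j 0 ^+ 2 * (w.2 i 0 - z.2 i 0)).
pose L := \sum_i (ln (z.2 i 0) + 1) * (w.2 i 0 - z.2 i 0).
set X1 := \sum_j _; have -> : X1 = U.
  rewrite /U exchange_big; apply: eq_bigr => j _; rewrite !mxE mulr_suml.
  by apply: eq_bigr => i _; ring.
set X2 := \sum_i _; have -> : X2 = W + 10 * N * L.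
  rewrite /W /L mulr_sumr -big_split; apply: eq_bigr => i _; rewrite !mxE mulrDl.
  by congr (_ + _); [rewrite mulr_suml; apply: eq_bigr => j _|]; ring.
have -> : \sum_i kl (w.2 i 0) (z.2 i 0) = X - Y - L by rewrite -!sumrB.
set D := \sum_i _; suff -> : D = P - Q - U - W by ring.
rewrite /P /Q /U /W -!sumrB; apply: eq_bigr => i _.
by rewrite -!sumrB; apply: eq_bigr => j _; ring.
Qed.

(** Since each [kl] is nonnegative, replacing N by the row sum of |A| only lowers the entropy term,
    which then splits over the entries of the row. *)
Lemma bregman_ge z w : boxsimplex z -> boxsimplex w -> regular z ->
  \sum_i \sum_j `|A i j| * entry_div (z.1 j 0) (z.2 i 0) (w.1 j 0) (w.2 i 0)
    <= bregman (areareg A) z w.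
Proof.
move=> zZ wZ zr; have [_ [w0 _]] := wZ.
case: (zr) => [N0|z0].
  rewrite bregmanE// N0 mulr0 mul0r addr0 (opnorm_eq0 N0).
  by apply: ler_sum => i _; apply: ler_sum => j _; rewrite mxE normr0 !mul0r.
rewrite bregmanE// mulr_sumr -big_split; apply: ler_sum => i _ /=.
rewrite (eq_bigr _ (fun j _ => mulrDr _ _ _)) big_split lerD2l -mulr_suml.
rewrite [leRHS](_ : _ = N * (10 * kl (w.2 i 0) (z.2 i 0))); last by ring.
by rewrite ler_wpM2r ?row_sum_le_opnorm// mulr_ge0 ?kl_ge0.
Qed.

Lemma bregman_ge0 z w : boxsimplex z -> boxsimplex w -> regular z ->
  0 <= bregman (areareg A) z w.
Proof.
move=> zZ wZ zr; case: (zr) => [N0|z0].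
  by rewrite bregmanE// N0 mulr0 mul0r addr0 (opnorm_eq0 N0) big1// => i _;
    rewrite big1// => j _; rewrite mxE normr0 mul0r.
have [_ [w0 _]] := wZ.
apply: le_trans (bregman_ge zZ wZ zr).
apply: sumr_ge0 => i _; apply: sumr_ge0 => j _; rewrite mulr_ge0//.
by apply: entry_div_ge0; rewrite ?box_norm_le1.
Qed.

(** A second-order bound along segments, so that the error vanishes after division by t in
    [prox_first_order]. The entropy part uses [kl_le]. *)
Lemma bregman_segment_le z u : boxsimplex z -> boxsimplex u -> regular z ->
  exists C, forall t, 0 < t <= 1 ->
    bregman (areareg A) z (z + t *: (u - z)) <= C * t ^+ 2.
Proof.
move=> zZ uZ zr; case: (zr) => [N0|z0].
  exists 0 => t _; rewrite bregmanE// N0 mulr0 mul0r addr0 (opnorm_eq0 N0).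
  by rewrite mul0r big1// => i _; rewrite big1// => j _; rewrite mxE normr0 mul0r.
have [_ [u0 _]] := uZ; have N0 := simplex_opnorm_ge0 zZ.
exists (\sum_i \sum_j `|A i j| * (z.2 i 0 * (u.1 j 0 - z.1 j 0) ^+ 2
    + `|u.2 i 0 - z.2 i 0| * (2 * `|z.1 j 0| * `|u.1 j 0 - z.1 j 0|
      + (u.1 j 0 - z.1 j 0) ^+ 2))
  + 10 * N * \sum_i (u.2 i 0 - z.2 i 0) ^+ 2 / z.2 i 0) => t /andP[t0 t1].
rewrite bregmanE// [leRHS]mulrDl -[in leRHS](mulrA (10 * N)) lerD//.
  rewrite mulr_suml ler_sum// => i _; rewrite mulr_suml ler_sum// => j _.
  rewrite -[leRHS]mulrA ler_wpM2l//= !mxE.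
  (* The cubic term t^3 dy dx^2 is absorbed into t^2 because t <= 1. *)
  have key (y x dx dy e f g : R) :
     dy * x * dx <= e * f * g -> dy * dx ^+ 2 <= e * dx ^+ 2 -> 0 <= e ->
     y * (x + t * dx - x) ^+ 2 + (y + t * dy - y) * ((x + t * dx) ^+ 2 - x ^+ 2)
     <= (y * dx ^+ 2 + e * (2 * f * g + dx ^+ 2)) * t ^+ 2.
    move=> h1 h2 e0; rewrite -subr_ge0.
    have -> : (y * dx ^+ 2 + e * (2 * f * g + dx ^+ 2)) * t ^+ 2 -
      (y * (x + t * dx - x) ^+ 2 + (y + t * dy - y) * ((x + t * dx) ^+ 2 - x ^+ 2))
      = 2 * t ^+ 2 * (e * f * g - dy * x * dx)
        + t ^+ 2 * (t * (e * dx ^+ 2 - dy * dx ^+ 2) + (1 - t) * (e * dx ^+ 2)) by ring.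
    apply: addr_ge0; first by rewrite mulr_ge0 ?subr_ge0// mulr_ge0 ?sqr_ge0.
    rewrite mulr_ge0 ?sqr_ge0//; apply: addr_ge0.
      by rewrite mulr_ge0 ?subr_ge0// ltW.
    by rewrite mulr_ge0 ?subr_ge0// mulr_ge0 ?sqr_ge0.
  apply: key => //.
    by rewrite -!normrM ler_norm.
  by rewrite ler_wpM2r ?sqr_ge0// ler_norm.
rewrite ler_wpM2l ?mulr_ge0// mulr_suml ler_sum// => i _ /=; rewrite !mxE.
have ui := u0 i; have zi := z0 i.
apply: le_trans (kl_le _ zi) _; first by nra.
by rewrite [leLHS](_ : _ = (u.2 i 0 - z.2 i 0) ^+ 2 / z.2 i 0 * t ^+ 2)//; ring.
Qed.

End Regularizer.

(** * Inner product, three-point identity and convexity of the box-simplex *)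

Section Bregman.
Set Implicit Arguments.
Unset Strict Implicit.
Variables (R : realType) (m n : nat).
Implicit Types u v w z : 'cV[R]_n * 'cV[R]_m.

Lemma dotC u v : dot u v = dot v u.
Proof. by congr (_ + _); apply: eq_bigr => i _; rewrite mulrC. Qed.

Lemma dotDl u v w : dot (u + v) w = dot u w + dot v w.
Proof.
rewrite /dot addrACA -!big_split.
by congr (_ + _); apply: eq_bigr => i _; rewrite !mxE mulrDl.
Qed.

Lemma dotZl a u v : dot (a *: u) v = a * dot u v.
Proof.
rewrite /dot mulrDr !mulr_sumr.
by congr (_ + _); apply: eq_bigr => i _; rewrite !mxE mulrA.
Qed.

Lemma dotNl u v : dot (- u) v = - dot u v.
Proof. by rewrite -scaleN1r dotZl mulN1r. Qed.

Lemma dotBl u v w : dot (u - v) w = dot u w - dot v w.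
Proof. by rewrite dotDl dotNl. Qed.

Lemma dotZr a u v : dot u (a *: v) = a * dot u v.
Proof. by rewrite dotC dotZl dotC. Qed.

Lemma dotBr u v w : dot w (u - v) = dot w u - dot w v.
Proof. by rewrite dotC dotBl !(dotC w). Qed.

Lemma three_point (r : 'cV[R]_n * 'cV[R]_m -> R) z w u :
  dot (gradient r w - gradient r z) (u - w) =
  bregman r z u - bregman r w u - bregman r z w.
Proof. by rewrite /bregman dotBl !dotBr; ring. Qed.

Lemma boxsimplex_segment z u t : boxsimplex z -> boxsimplex u -> 0 < t <= 1 ->
  boxsimplex (z + t *: (u - z)).
Proof.
move=> [zb [z0 z1]] [ub [u0 u1]] /andP[t0 t1]; split=> [j|].
  by have := zb j; have := ub j; rewrite !mxE => /andP[? ?] /andP[? ?]; nra.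
split=> [i|]; first by have := z0 i; have := u0 i; rewrite !mxE; nra.
transitivity (\sum_i (z.2 i 0 + t * (u.2 i 0 - z.2 i 0))).
  by apply: eq_bigr => i _; rewrite !mxE.
by rewrite big_split -mulr_sumr sumrB /= z1 u1 subrr mulr0 addr0.
Qed.

End Bregman.

(** * Optimality conditions of proximal steps and multiplicative stability *)

Section Prox.
Set Implicit Arguments.
Unset Strict Implicit.
Variables (R : realType) (m n : nat) (A : 'M[R]_(m, n)).
Implicit Types z w u xi : 'cV[R]_n * 'cV[R]_m.

Local Notation N := (opnorm_oo A).
Local Notation r := (areareg A).
Local Notation V := (bregman r).
Local Notation prox := (is_prox (@boxsimplex R m n) r).

Lemma boxsimplex_pos z : 0 < N -> regular A z -> forall i, 0 < z.2 i 0.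
Proof. by move=> N0 [Nz|//]; rewrite Nz ltxx in N0. Qed.

(* At a vanishing coordinate of [w] the entropy has slope [-oo] in the direction
   of [z]. *)
Lemma prox_regular z xi w : boxsimplex z -> regular A z -> prox z xi w ->
  regular A w.
Proof.
move=> zZ zr [wZ wmin]; have [|N0] := eqVneq N 0; first by left.
have {}N0 : 0 < N by rewrite lt_neqAle eq_sym N0 (simplex_opnorm_ge0 A zZ).
right => i; have z0 := boxsimplex_pos N0 zr.
have [_ [w0 _]] := wZ.
rewrite lt_neqAle w0 andbT eq_sym; apply/eqP => wi.
(* Moving only the simplex part makes y^T |A| x^2 affine along the direction. *)
pose d : 'cV[R]_n * 'cV[R]_m := (w.1, z.2) - w.
have dZ : boxsimplex (w.1, z.2) by split; [exact: wZ.1|exact: zZ.2].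
pose C := dot (xi - gradient r z) d
  + \sum_i \sum_j `|A i j| * (d.2 i 0 * w.1 j 0 ^+ 2)
  + 10 * N * \sum_i (z.2 i 0 * ln (z.2 i 0) - w.2 i 0 * ln (w.2 i 0)).
have key t : 0 < t <= 1 -> 0 <= C + 10 * N * (z.2 i 0 * ln t).
  move=> /[dup] t01 /andP[t0 t1].
  have := wmin _ (boxsimplex_segment wZ dZ t01).
  rewrite -/d -subr_ge0 /bregman.
  set wt := w + t *: d.
  have -> : dot xi wt + (r wt - r z - dot (gradient r z) (wt - z))
     - (dot xi w + (r w - r z - dot (gradient r z) (w - z)))
     = dot (xi - gradient r z) (wt - w) + (r wt - r w).
    by rewrite dotBl !dotBr; ring.
  rewrite /wt [w + _ - w]addrAC subrr add0r dotZr !areareg_sumE -/wt => H.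
  rewrite -(@pmulr_rge0 _ t)//; apply: le_trans H _.
  have -> : \sum_i \sum_j `|A i j| * (wt.2 i 0 * wt.1 j 0 ^+ 2) =
      \sum_i \sum_j `|A i j| * (w.2 i 0 * w.1 j 0 ^+ 2)
      + t * \sum_i \sum_j `|A i j| * (d.2 i 0 * w.1 j 0 ^+ 2).
    rewrite mulr_sumr -big_split; apply: eq_bigr => k _ /=.
    rewrite mulr_sumr -big_split; apply: eq_bigr => j _ /=.
    by rewrite !mxE subrr mulr0 addr0; ring.
  (* Convexity handles the other coordinates; coordinate i is exactly t z_i and contributes the
     extra t z_i log t. *)
  have ent : \sum_i wt.2 i 0 * ln (wt.2 i 0) <= \sum_i w.2 i 0 * ln (w.2 i 0)
     + t * \sum_i (z.2 i 0 * ln (z.2 i 0) - w.2 i 0 * ln (w.2 i 0))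
     + t * (z.2 i 0 * ln t).
    rewrite mulr_sumr -big_split /= (bigD1 i)//= [in leRHS](bigD1 i)//= addrAC.
    apply: lerD; last first.
      by apply: ler_sum => k _; rewrite !mxE xlnx_convex.
    rewrite !mxE wi subr0 mul0r !add0r subr0 lnM ?posrE//.
    by rewrite le_eqVlt; apply/orP; left; apply/eqP; ring.
  have N10 : 0 <= 10 * N by rewrite mulr_ge0// ltW.
  have := ler_wpM2l N10 ent; rewrite /C; move: (ln t).
  set P := \sum_i \sum_j _; set Q := \sum_i \sum_j _.
  set S := \sum_i _; set S' := \sum_i _; set S'' := \sum_i _; set D := dot _ _.
  by move=> l h; nra.
pose a := 10 * N * z.2 i 0.
have a0 : 0 < a by rewrite !mulr_gt0.
(* With this t the logarithmic term is -(|C| + 1), which contradicts [key]. *)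
have t0 : 0 < expR (- (`|C| + 1) / a) <= 1.
  rewrite expR_gt0 -expR0 ler_expR /= mulNr oppr_le0 divr_ge0 ?addr_ge0//.
  exact: ltW.
have := key _ t0; rewrite expRK.
rewrite [10 * N * _]mulrA -/a mulrC [_ / a * a]divfK ?gt_eqF//.
by have := ler_norm C; lra.
Qed.

(** Minimality is tested at w + t (u - w): the three-point identity isolates t times the claimed
    quantity, up to a divergence from w of order t^2. *)
Lemma prox_first_order z xi w u : boxsimplex u ->
    regular A w -> prox z xi w ->
  0 <= dot (xi + (gradient r w - gradient r z)) (u - w).
Proof.
move=> uZ wr [wZ wmin].
have [C hC] := bregman_segment_le wZ uZ wr.
set S := dot _ _.
have key t : 0 < t <= 1 -> 0 <= S + C * t.
  move=> /[dup] t01 /andP[t0 t1].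
  have := wmin _ (boxsimplex_segment wZ uZ t01).
  have := hC _ t01; set wt := w + _ => h1 h2.
  rewrite -(@pmulr_rge0 _ t)//.
  have : t * S = dot xi (wt - w) + V z wt - V w wt - V z w.
    rewrite -addrA -addrA [_ + (_ - _)]addrA -three_point -dotDl.
    by rewrite /wt [w + _ - w]addrAC subrr add0r dotZr.
  by rewrite dotBr => hS; nra.
rewrite leNgt; apply/negP => S0.
have C1 : 0 < `|C| + 1 - S by have := normr_ge0 C; lra.
(* This t is small enough that S + C t keeps the negative sign of S. *)
have t01 : 0 < - S / (`|C| + 1 - S) <= 1.
  rewrite divr_gt0 ?oppr_gt0//= ler_pdivrMr// mul1r.
  by have := normr_ge0 C; lra.
have := key _ t01.
rewrite -(@pmulr_lge0 _ (`|C| + 1 - S))// mulrDl -mulrA divfK ?gt_eqF//.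
by have := ler_norm C; have := normr_ge0 C; nra.
Qed.

Lemma prox_ineq z xi w u : boxsimplex u -> regular A w -> prox z xi w ->
  dot xi (w - u) <= V z u - V w u - V z w.
Proof.
move=> uZ wr wp; have := prox_first_order uZ wr wp.
by rewrite dotDl three_point !dotBr; lra.
Qed.

(** Stationarity on the simplex at a positive point, stated without naming the Lagrange
    multiplier. *)
Definition flat (y : 'cV[R]_m) := forall i k, y i 0 = y k 0.

(* Moving the whole mass of one simplex coordinate to another one is a feasible
   direction. *)
Lemma prox_flat z xi w : 0 < N -> regular A w -> prox z xi w ->
  flat (xi + (gradient r w - gradient r z)).2.
Proof.
move=> N0 wr wp; set F := xi + _; have w0 := boxsimplex_pos N0 wr.
have le i k : i != k -> F.2 i 0 <= F.2 k 0.
  move=> ik; have [[wb [_ w1]] _] := wp.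
  pose u : 'cV[R]_n * 'cV[R]_m :=
    (w.1, w.2 + w.2 i 0 *: (delta_mx k 0 - delta_mx i 0)).
  have uZ : boxsimplex u.
    split=> //; split=> [l|].
      rewrite !mxE !eqxx !andbT; have [->|li] := eqVneq l i.
        by rewrite (negbTE ik) /= mulr0n sub0r mulrN1 subrr.
      by rewrite subr0; have := w0 l; have := w0 i; case: (l == k) => /=; lra.
    transitivity (\sum_l (w.2 l 0 + (w.2 i 0 * (l == k)%:R - w.2 i 0 * (l == i)%:R))).
      by apply: eq_bigr => l _; rewrite !mxE eqxx !andbT mulrBr.
    by rewrite big_split sumrB /= !sum_delta subrr addr0.
  have := prox_first_order uZ wr wp; rewrite -/F /dot.
  rewrite big1 ?add0r => [|j _]; last by rewrite !mxE subrr mulr0.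
  rewrite (eq_bigr (fun l => w.2 i 0 * F.2 l 0 * (l == k)%:R
     - w.2 i 0 * F.2 l 0 * (l == i)%:R)) => [|l _]; last first.
    by rewrite !mxE eqxx !andbT; ring.
  by rewrite sumrB !sum_delta -mulrBr pmulr_rge0// subr_ge0.
move=> i k; have [->//|ik] := eqVneq i k.
by apply/le_anti; rewrite !le// eq_sym.
Qed.

(** Equal sums give a coordinate k that does not grow, so log(y_i / y'_i) >= -1/3; then log q <= q -
    1 yields y_i / y'_i >= 2/3. *)
Lemma simplex_ratio (y y' : 'cV[R]_m) : simplex y -> simplex y' ->
    (forall i, 0 < y i 0) -> (forall i, 0 < y' i 0) ->
    (forall i k, ln (y' i 0) - ln (y i 0) - (ln (y' k 0) - ln (y k 0)) <= 1 / 3) ->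
  forall i, y' i 0 <= 3 / 2 * y i 0.
Proof.
move=> [_ y1] [_ y'1] y0 y'0 h i.
have [k yk] : exists k, y' k 0 <= y k 0.
  apply: contrapT => /forallNP H0.
  have H k : y k 0 < y' k 0 by rewrite ltNge; apply/negP.
  have : \sum_i y i 0 < \sum_i y' i 0.
    rewrite (bigD1 i)//= [ltRHS](bigD1 i)//= ltr_leD//.
    by apply: ler_sum => k _; exact: ltW.
  by rewrite y1 y'1 ltxx.
have lnk : ln (y' k 0) <= ln (y k 0) by rewrite ler_ln ?posrE.
have q0 : 0 < y i 0 / y' i 0 by rewrite divr_gt0.
have := ln_le_subr1 q0; rewrite ln_div ?posrE// => lq.
have : 2 / 3 <= y i 0 / y' i 0 by have := h i k; lra.
by rewrite ler_pdivlMr//; lra.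
Qed.

(** Flatness bounds 10 N times a difference of log-ratios by 4N/3 from v plus 2N from |A|(x^2),
    hence the 1/3. The bound is symmetric in i and k, which gives both directions. *)
Lemma step_stable (p q : 'cV[R]_n * 'cV[R]_m) (v : 'cV[R]_m) : 0 < N ->
    boxsimplex p -> boxsimplex q -> regular A p -> regular A q ->
    flat (v + (gradient r q - gradient r p).2) ->
    (forall i k, v i 0 - v k 0 <= 4 / 3 * N) ->
  forall i, p.2 i 0 <= 3 / 2 * q.2 i 0 /\ q.2 i 0 <= 3 / 2 * p.2 i 0.
Proof.
move=> N0 pZ qZ pr qr fl hv.
have p0 := boxsimplex_pos N0 pr; have q0 := boxsimplex_pos N0 qr.
have S01 u i : boxsimplex u -> 0 <= \sum_j `|A i j| * u.1 j 0 ^+ 2 <= N.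
  move=> uZ; rewrite sumr_ge0/= => [|j _]; last by rewrite mulr_ge0 ?sqr_ge0.
  apply: le_trans (row_sum_le_opnorm A i); apply: ler_sum => j _.
  by rewrite ler_piMr// -real_normK ?num_real// expr_le1// box_norm_le1.
have h i k : ln (q.2 i 0) - ln (p.2 i 0) - (ln (q.2 k 0) - ln (p.2 k 0)) <= 1 / 3.
  have := fl i k; rewrite !gradientE// !mxE.
  have := hv k i; have := S01 _ i pZ; have := S01 _ k pZ.
  have := S01 _ i qZ; have := S01 _ k qZ.
  do 4!move=> /andP[? ?].
  move=> hvi hf; rewrite -(ler_pM2l N0); lra.
move=> i; split; apply: simplex_ratio => //;
  try by [exact: pZ.2 | exact: qZ.2].
by move=> j k; have := h k j; lra.
Qed.

(** * Relative Lipschitzness of the gradient operator *)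

Section BoxSimplexGame.
Variables (b : 'cV[R]_m) (c : 'cV[R]_n).
Hypothesis hb : forall i, 0 <= b i 0 <= 2 * N.
Local Notation g := (gradop A b c).

Lemma mulmx_box_le z i : boxsimplex z -> `|(A *m z.1) i 0| <= N.
Proof.
move=> zZ; apply: le_trans (row_sum_le_opnorm A i); rewrite -[leRHS]mulr1.
by apply: mulmx_entry_le => j; exact: box_norm_le1.
Qed.

Lemma dot_gradopB z w u : dot (g w - g z) (w - u) =
  \sum_i \sum_j A i j * ((u.2 i 0 - w.2 i 0) * (w.1 j 0 - z.1 j 0)
    - (w.2 i 0 - z.2 i 0) * (u.1 j 0 - w.1 j 0)).
Proof.
rewrite /dot.
have -> : \sum_j (g w - g z).1 j 0 * (w - u).1 j 0 =
    \sum_i \sum_j A i j * (w.2 i 0 - z.2 i 0) * (w.1 j 0 - u.1 j 0).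
  rewrite exchange_big; apply: eq_bigr => j _.
  rewrite !mxE -mulr_suml; congr (_ * _).
  rewrite opprD addrACA subrr addr0 -sumrB.
  by apply: eq_bigr => i _; rewrite !mxE mulrBr.
rewrite -big_split; apply: eq_bigr => i _ /=.
have -> : (g w - g z).2 i 0 = \sum_j A i j * (z.1 j 0 - w.1 j 0).
  rewrite !mxE opprB addrC addrA subrK -sumrB.
  by apply: eq_bigr => j _; rewrite mulrBr.
rewrite mulr_suml -big_split; apply: eq_bigr => j _ /=.
by rewrite !mxE; ring.
Qed.

(** The two flatness hypotheses are the form of optimality that mirror prox and dual extrapolation
    share. *)
Lemma relative_lipschitz z w u :
    boxsimplex z -> boxsimplex w -> boxsimplex u ->
    regular A z -> regular A w -> regular A u ->
    (0 < N -> flat (3^-1 *: g z + (gradient r w - gradient r z)).2) ->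
    (0 < N -> flat (3^-1 *: (g w - g z) + (gradient r u - gradient r w)).2) ->
  dot (g w - g z) (w - u) <= 3 * (V z w + V w u).
Proof.
move=> zZ wZ uZ zr wr ur fzw fwu.
have [N0|N0] := eqVneq N 0.
  have -> : dot (g w - g z) (w - u) = 0.
    rewrite dot_gradopB (opnorm_eq0 N0) big1// => i _.
    by rewrite big1// => j _; rewrite mxE mul0r.
  by apply: mulr_ge0 => //; apply: addr_ge0; exact: bregman_ge0.
have {}N0 : 0 < N by rewrite lt_neqAle eq_sym N0 (simplex_opnorm_ge0 A zZ).
have AxN (v : 'cV[R]_n * 'cV[R]_m) i : boxsimplex v -> - N <= (A *m v.1) i 0 <= N.
  by move=> vZ; rewrite -ler_norml mulmx_box_le.
have zw : forall i, z.2 i 0 <= 3 / 2 * w.2 i 0 /\ w.2 i 0 <= 3 / 2 * z.2 i 0.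
  (* Between two coordinates b and Ax each differ by at most 2N, in total 4N before the factor
     1/3. *)
  apply: (step_stable (v := 3^-1 *: (g z).2) N0 zZ wZ zr wr (fzw N0)) => i k.
  have gE l : (3^-1 *: (g z).2) l 0 = 3^-1 * (b l 0 - (A *m z.1) l 0).
    by rewrite !mxE.
  rewrite !gE; have := AxN _ i zZ; have := AxN _ k zZ; have := hb i; have := hb k.
  by do 4!move=> /andP[? ?]; lra.
have wu : forall i, w.2 i 0 <= 3 / 2 * u.2 i 0 /\ u.2 i 0 <= 3 / 2 * w.2 i 0.
  (* Here b cancels, and the two values of Ax account for 4N. *)
  apply: (step_stable (v := 3^-1 *: ((g w).2 - (g z).2)) N0 wZ uZ wr ur (fwu N0)) => i k.
  have gE l : (3^-1 *: ((g w).2 - (g z).2)) l 0 =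
      3^-1 * ((A *m z.1) l 0 - (A *m w.1) l 0) by rewrite !mxE; ring.
  rewrite !gE; have := AxN _ i zZ; have := AxN _ k zZ.
  have := AxN _ i wZ; have := AxN _ k wZ.
  by do 4!move=> /andP[? ?]; lra.
apply: le_trans (ler_wpM2l _ (lerD (bregman_ge zZ wZ zr) (bregman_ge wZ uZ wr))) => //.
rewrite dot_gradopB -big_split mulr_sumr; apply: ler_sum => i _ /=.
rewrite -big_split mulr_sumr; apply: ler_sum => j _ /=.
rewrite -mulrDr mulrCA (le_trans (ler_norm _))// normrM ler_wpM2l//.
have z0 := boxsimplex_pos N0 zr; have w0 := boxsimplex_pos N0 wr.
have u0 := boxsimplex_pos N0 ur.
by apply: entry_rel_lip; rewrite ?box_norm_le1 ?(zw i).1 ?(zw i).2 ?(wu i).2.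
Qed.

End BoxSimplexGame.
End Prox.

(** * Regret of mirror prox and dual extrapolation *)

Section Iterations.
Set Implicit Arguments.
Unset Strict Implicit.
Variables (R : realType) (m n : nat) (A : 'M[R]_(m, n)).
Variables (b : 'cV[R]_m) (c : 'cV[R]_n).
Hypothesis hb : forall i, 0 <= b i 0 <= 2 * opnorm_oo A.
Implicit Types u z w xi : 'cV[R]_n * 'cV[R]_m.

Local Notation Z := (@boxsimplex R m n).
Local Notation r := (areareg A).
Local Notation V := (bregman r).
Local Notation prox := (is_prox Z r).
Local Notation g := (gradop A b c).

Lemma prox_rel_lip z w u : Z z -> Z u -> regular A z -> regular A u ->
    prox z (3^-1 *: g z) w ->
    (0 < opnorm_oo A ->
       flat (3^-1 *: (g w - g z) + (gradient r u - gradient r w)).2) ->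
  dot (g w - g z) (w - u) <= 3 * (V z w + V w u).
Proof.
move=> zZ uZ zr ur wp fwu; have wr := prox_regular zZ zr wp.
apply: relative_lipschitz => //; first by case: wp.
by move=> N0; exact: prox_flat wp.
Qed.

(** [prox_ineq] for w against u supplies -V z w - V w u, which absorbs the Lipschitz bound. *)
Lemma rel_lip_step z w u : Z z -> Z u -> regular A z -> prox z (3^-1 *: g z) w ->
    dot (g w - g z) (w - u) <= 3 * (V z w + V w u) ->
  dot (g w) (w - u) <= 3 * V z u.
Proof.
move=> zZ uZ zr wp; have wr := prox_regular zZ zr wp.
by have := prox_ineq uZ wr wp; rewrite dotZl dotBl; lra.
Qed.

Lemma snd_entryD u w i : (u + w).2 i 0 = u.2 i 0 + w.2 i 0.
Proof. by rewrite mxE. Qed.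

Lemma snd_entryN u i : (- u).2 i 0 = - u.2 i 0.
Proof. by rewrite mxE. Qed.

(** The gradient at the common center z cancels between the two optimality conditions. *)
Lemma prox_flat_diff z xi xi' w w' : 0 < opnorm_oo A -> Z z -> regular A z ->
    prox z xi w -> prox z xi' w' ->
  flat (xi' - xi + (gradient r w' - gradient r w)).2.
Proof.
move=> N0 zZ zr wp wp' i k.
have := prox_flat N0 (prox_regular zZ zr wp) wp i k.
have := prox_flat N0 (prox_regular zZ zr wp') wp' i k.
by rewrite !(snd_entryD, snd_entryN); lra.
Qed.

Lemma mirror_prox_regular T z0 (z w : nat -> 'cV[R]_n * 'cV[R]_m) :
    Z z0 -> regular A z0 ->
    mirror_prox Z g r 3 T z0 z w ->
  forall t, (t <= T)%N -> Z (z t) /\ regular A (z t).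
Proof.
move=> z0Z z0r [z00 zw]; elim=> [|t IH] tT; first by rewrite z00.
have [zZ zr] := IH (ltnW tT); have [_ zp] := zw _ tT.
by split; [case: zp|exact: prox_regular zp].
Qed.

Lemma mirror_prox_rel_lip T z0 (z w : nat -> 'cV[R]_n * 'cV[R]_m) t :
    Z z0 -> regular A z0 ->
    mirror_prox Z g r 3 T z0 z w -> (t < T)%N ->
  dot (g (w t) - g (z t)) (w t - z t.+1) <= 3 * (V (z t) (w t) + V (w t) (z t.+1)).
Proof.
move=> z0Z z0r mp tT.
have [zZ zr] := mirror_prox_regular z0Z z0r mp (ltnW tT).
have [zZ' zr'] := mirror_prox_regular z0Z z0r mp tT.
have [wp zp] := mp.2 _ tT.
apply: prox_rel_lip => // N0.
by rewrite scalerBr; apply: prox_flat_diff wp zp.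
Qed.

Lemma mirror_prox_regret T z0 (z w : nat -> 'cV[R]_n * 'cV[R]_m) u :
    Z z0 -> regular A z0 ->
    mirror_prox Z g r 3 T z0 z w -> Z u ->
  \sum_(0 <= t < T) dot (g (w t)) (w t - u) <= 3 * V z0 u.
Proof.
move=> z0Z z0r mp uZ.
suff H k : (k <= T)%N ->
    \sum_(0 <= t < k) dot (g (w t)) (w t - u) <= 3 * (V z0 u - V (z k) u).
  have [zZ zr] := mirror_prox_regular z0Z z0r mp (leqnn T).
  by have := H T (leqnn T); have := bregman_ge0 zZ uZ zr; lra.
elim: k => [_|k IH kT]; first by rewrite big_nil mp.1 subrr mulr0.
rewrite big_nat_recr//=; have := IH (ltnW kT).
have [zZ zr] := mirror_prox_regular z0Z z0r mp (ltnW kT).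
have [zZ' zr'] := mirror_prox_regular z0Z z0r mp kT.
have [wp zp] := mp.2 _ kT.
(* Splitting w - u at the next iterate, the two bounds share V (z k) (z k.+1) with opposite
   signs. *)
have := rel_lip_step zZ zZ' zr wp (mirror_prox_rel_lip z0Z z0r mp kT).
have := prox_ineq uZ zr' zp; rewrite dotZl !dotBr; lra.
Qed.

Lemma dual_extrapolation_regular T zb (s z w : nat -> 'cV[R]_n * 'cV[R]_m) t :
    Z zb -> regular A zb ->
    dual_extrapolation Z g r 3 T zb s z w -> (t <= T)%N ->
  prox zb (s t) (z t) /\ regular A (z t).
Proof.
move=> zbZ zbr [_ sw sT] tT.
have zp : prox zb (s t) (z t).
  by move: tT; rewrite leq_eqVlt => /predU1P[->//|/sw[]].
by split => //; exact: prox_regular zp.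
Qed.

Lemma dual_extrapolation_rel_lip T zb (s z w : nat -> 'cV[R]_n * 'cV[R]_m) t :
    Z zb -> regular A zb ->
    dual_extrapolation Z g r 3 T zb s z w -> (t < T)%N ->
  dot (g (w t) - g (z t)) (w t - z t.+1) <= 3 * (V (z t) (w t) + V (w t) (z t.+1)).
Proof.
move=> zbZ zbr de tT.
have [zp zr] := dual_extrapolation_regular zbZ zbr de (ltnW tT).
have [zp' zr'] := dual_extrapolation_regular zbZ zbr de tT.
have [_ /(_ _ tT)[_ wp st] _] := de.
apply: prox_rel_lip => //; [by case: zp|by case: zp'|move=> N0 i k].
(* The centers of w and the next iterate differ; the condition linking both z iterates, taken from
   [zb], minus that of w gives the required one. *)
have := prox_flat N0 (prox_regular zp.1 zr wp) wp i k.
have := prox_flat_diff N0 zbZ zbr zp zp' i k.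
rewrite st [s t + _ - s t]addrAC subrr add0r scalerBr.
by rewrite !(snd_entryD, snd_entryN); lra.
Qed.

Lemma dual_extrapolation_regret T zb (s z w : nat -> 'cV[R]_n * 'cV[R]_m) u :
    Z zb -> regular A zb ->
    dual_extrapolation Z g r 3 T zb s z w -> Z u ->
  \sum_(0 <= t < T) dot (g (w t)) (w t - u) <= 3 * V zb u.
Proof.
move=> zbZ zbr de uZ.
(* The potential is the proximal objective at its minimizer [z k], less the linear term at u; at k =
   T minimality against u bounds it by V zb u. *)
suff H k : (k <= T)%N ->
    \sum_(0 <= t < k) dot (g (w t)) (w t - u)
      <= 3 * (dot (s k) (z k) + V zb (z k) - dot (s k) u).
  have [[_ zmin] _] := dual_extrapolation_regular zbZ zbr de (leqnn T).
  by have := H T (leqnn T); have := zmin _ uZ; lra.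
have [s0 sw _] := de.
elim: k => [_|k IH kT].
  have [[zZ _] _] := dual_extrapolation_regular zbZ zbr de (leq0n T).
  rewrite big_nil s0 -(scale0r (0 : 'cV[R]_n * 'cV[R]_m)) !dotZl !mul0r add0r subr0.
  by rewrite mulr_ge0// bregman_ge0.
rewrite big_nat_recr//=; have := IH (ltnW kT).
have [zp zr] := dual_extrapolation_regular zbZ zbr de (ltnW kT).
have [[zZ' _] _] := dual_extrapolation_regular zbZ zbr de kT.
have [_ wp ->] := sw _ kT.
(* By [prox_ineq], the minimum rises by at least V (z k) (z k.+1) plus the new linear term at the
   next iterate, which pays for this step. *)
have := rel_lip_step zp.1 zZ' zr wp (dual_extrapolation_rel_lip zbZ zbr de kT).
have := prox_ineq zZ' zr zp; rewrite !dotDl !dotZl !dotBr; lra.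
Qed.

End Iterations.

Theorem theorem2 (R : realType) (m n : nat) (A : 'M[R]_(m, n))
    (c : 'cV[R]_n) (b : 'cV[R]_m)
    (hb : forall i, 0 <= b i 0 <= 2 * opnorm_oo A) (T : nat) :
  let Z := @boxsimplex R m n in
  let g := gradop A b c in
  let r := areareg A in
  let V := bregman r in
  (forall (z0 : 'cV[R]_n * 'cV[R]_m) (z w : nat -> 'cV[R]_n * 'cV[R]_m),
     Z z0 -> (forall i, 0 < z0.2 i 0) ->
     mirror_prox Z g r 3 T z0 z w ->
     (forall t, (t < T)%N ->
        dot (g (w t) - g (z t)) (w t - z t.+1)
          <= 3 * (V (z t) (w t) + V (w t) (z t.+1))) /\
     (forall u, Z u ->
        \sum_(0 <= t < T) dot (g (w t)) (w t - u) <= 3 * V z0 u)) /\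
  (forall (zbar : 'cV[R]_n * 'cV[R]_m)
          (s z w : nat -> 'cV[R]_n * 'cV[R]_m),
     Z zbar -> (forall i, 0 < zbar.2 i 0) ->
     dual_extrapolation Z g r 3 T zbar s z w ->
     (forall t, (t < T)%N ->
        dot (g (w t) - g (z t)) (w t - z t.+1)
          <= 3 * (V (z t) (w t) + V (w t) (z t.+1))) /\
     (forall u, Z u ->
        \sum_(0 <= t < T) dot (g (w t)) (w t - u) <= 3 * V zbar u)).
Proof.
split=> [z0 z w z0Z z0pos mp|zbar s z w zbZ zbpos de]; split.
- by move=> t; apply: (mirror_prox_rel_lip hb z0Z _ mp); right.
- by move=> u; apply: (mirror_prox_regret hb z0Z _ mp); right.
- by move=> t; apply: (dual_extrapolation_rel_lip hb zbZ _ de); right.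
- by move=> u; apply: (dual_extrapolation_regret hb zbZ _ de); right.
Qed.
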